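(* Let $R$ be a $2$-torsion free semiprime ring and let $U$ be a square closed Lie ideal of $R$. If $f: R\to R$ is an antihomomorphism of $R$ such that $f(U)=U$, then $f$ is centralizing on $U$ if and only if $f$ is strong commutativity preserving on $U$.
   Context: All rings are associative with identity (not necessarily commutative); $Z(R)$ is the center of $R$ and $[x,y]=xy-yx$. $R$ is $2$-torsion free if $2x=0$ implies $x=0$ for $x\in R$. $R$ is semiprime if, for $a\in R$, $aRa=0$ implies $a=0$. A Lie ideal of $R$ is an additive subgroup $U$ of $R$ with $[u,r]\in U$ for all $u\in U$, $r\in R$; it is square closed if moreover $u^2\in U$ for all $u\in U$. An antihomomorphism of $R$ is an additive map $f:R\to R$ with $f(xy)=f(y)f(x)$ for all $x,y\in R$. For a subset $S\subseteq R$, a map $f:R\to R$ is centralizing on $S$ if $[f(x),x]\in Z(R)$ for all $x\in S$, and is strong commutativity preserving on $S$ if $[f(x),f(y)]=[x,y]$ for all $x,y\in S$. *)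

(* Defs.v *)
From HB Require Import structures.
From mathcomp Require Import all_boot all_algebra.
From mathcomp Require Import boolp classical_sets.

Set Implicit Arguments.
Unset Strict Implicit.
Unset Printing Implicit Defensive.

Import GRing.Theory.
Local Open Scope classical_set_scope.
Local Open Scope ring_scope.

Definition lie_bracket (R : pzRingType) (x y : R) : R := x * y - y * x.

Definition ring_center (R : pzRingType) : set R :=
  [set z | forall x : R, z * x = x * z].

Definition two_torsion_free (R : pzRingType) : Prop :=
  forall x : R, x *+ 2 = 0 -> x = 0.

Definition semiprime_ring (R : pzRingType) : Prop :=
  forall a : R, (forall x : R, a * x * a = 0) -> a = 0.

Definition lie_ideal (R : pzRingType) (U : set R) : Prop :=
  zmod_closed (mem U) /\ forall u r : R, U u -> U (lie_bracket u r).

Definition square_closed (R : pzRingType) (U : set R) : Prop :=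
  forall u : R, U u -> U (u ^+ 2).

(* [f 1 = 1] is not required, hence not a [{rmorphism R -> R^c}]. *)
Definition antihomomorphism (R : pzRingType) (f : R -> R) : Prop :=
  {morph f : x y / x + y} /\ forall x y : R, f (x * y) = f y * f x.

Definition centralizing_on (R : pzRingType) (S : set R) (f : R -> R) : Prop :=
  forall x : R, S x -> ring_center (lie_bracket (f x) x).

Definition strong_commutativity_preserving_on
    (R : pzRingType) (S : set R) (f : R -> R) : Prop :=
  forall x y : R, S x -> S y ->
    lie_bracket (f x) (f y) = lie_bracket x y.

(* Main.v *)
(* If [f] is centralizing on [U], linearizing at [x, x ^+ 2] gives [[f x,x] ^+ 2 = 0]
   with [[f x,x]] central, so [f] is even commuting.  Put [c x = x + f x].  Both
   commuting and strong commutativity preserving give [[q,y] p = q [q,y]] for [y] in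
   [U], with [{p, q} = {x, f x}]; expanding this at a product in [U] yields
   [[q,y] [c x,z] = 0], hence [[q,y] U [c x,z] = 0].  Since [U] contains
   [2 R [U,U] R], semiprimeness upgrades this to [[q,y] R [c x,z] = 0], and
   linearizing in [x] separates the two factors, so that [[c x,z] R [c x,z] = 0].
   Thus [f] is [- id] on [U] modulo elements commuting with [U], from which both
   properties follow. *)

Require Import Defs.
From mathcomp Require Import all_boot all_algebra.
From mathcomp Require Import boolp classical_sets.

Import GRing.Theory.
Local Open Scope classical_set_scope.
Local Open Scope ring_scope.

Lemma lie_bracketDl (R : pzRingType) (x y z : R) :
  lie_bracket (x + y) z = lie_bracket x z + lie_bracket y z.
Proof. by rewrite /lie_bracket mulrDl mulrDr opprD addrACA. Qed.

Lemma lie_bracketDr (R : pzRingType) (x y z : R) :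
  lie_bracket x (y + z) = lie_bracket x y + lie_bracket x z.
Proof. by rewrite /lie_bracket mulrDl mulrDr opprD addrACA. Qed.

Lemma lie_bracketC (R : pzRingType) (x y : R) :
  lie_bracket x y = - lie_bracket y x.
Proof. by rewrite /lie_bracket opprB. Qed.

Lemma lie_bracketxx (R : pzRingType) (x : R) : lie_bracket x x = 0.
Proof. by rewrite /lie_bracket subrr. Qed.

Lemma lie_bracketMr (R : pzRingType) (x y z : R) :
  lie_bracket x (y * z) = lie_bracket x y * z + y * lie_bracket x z.
Proof. by rewrite /lie_bracket mulrBl mulrBr !mulrA addrA subrK. Qed.

Lemma lie_bracketMl (R : pzRingType) (x y z : R) :
  lie_bracket (x * y) z = x * lie_bracket y z + lie_bracket x z * y.
Proof. by rewrite /lie_bracket mulrBl mulrBr !mulrA addrA subrK. Qed.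

Lemma lie_bracketMnr (R : pzRingType) (x y : R) n :
  lie_bracket x (y *+ n) = lie_bracket x y *+ n.
Proof. by rewrite /lie_bracket mulrnAl mulrnAr -mulrnBl. Qed.

Lemma lie_ideal_sub {R : pzRingType} {U : set R} {x y : R} :
  lie_ideal U -> U x -> U y -> U (x - y).
Proof.
by move=> [[_ UB] _] Ux Uy; apply: set_mem; apply: UB; apply: mem_set.
Qed.

Lemma lie_ideal_add {R : pzRingType} {U : set R} {x y : R} :
  lie_ideal U -> U x -> U y -> U (x + y).
Proof.
move=> UL Ux Uy; have U0 := lie_ideal_sub UL Ux Ux.
rewrite -[y]opprK -[- y]sub0r -(subrr x).
exact: lie_ideal_sub UL Ux (lie_ideal_sub UL U0 Uy).
Qed.

(** Squares supply [x y + y x], the Lie ideal property supplies [x y - y x]; add the two. *)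
Lemma square_closed_mul2 {R : pzRingType} {U : set R} {x y : R} :
  lie_ideal U -> square_closed U -> U x -> U y -> U (x * y *+ 2).
Proof.
move=> UL US Ux Uy.
have -> : x * y *+ 2 = ((x + y) ^+ 2 - x ^+ 2 - y ^+ 2) + lie_bracket x y.
  have -> : (x + y) ^+ 2 - x ^+ 2 - y ^+ 2 = x * y + y * x.
    apply/eqP; rewrite !subr_eq !expr2 mulrDl !mulrDr; apply/eqP.
    by rewrite -!addrA [LHS]addrC -!addrA.
  by rewrite /lie_bracket addrACA subrr addr0 mulr2n.
apply: (lie_ideal_add UL); last by case: UL => _; apply.
apply: (lie_ideal_sub UL); last exact: US.
by apply: (lie_ideal_sub UL); apply: US => //; apply: (lie_ideal_add UL).
Qed.

(** The Leibniz rule [[u, v t] = [u, v] t + v [u, t]] puts [2 [u, v] t] in [U]; a bracket of [2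
    [u, v] s] with [r] then moves [r] to the left side. *)
Lemma square_closed_ideal {R : pzRingType} {U : set R} {u v : R} (r s : R) :
  lie_ideal U -> square_closed U -> U u -> U v ->
  U (r * lie_bracket u v * s *+ 2).
Proof.
move=> UL US Uu Uv; have [_ Ubr] := UL.
have Uright t : U (lie_bracket u v * t *+ 2).
  have -> : lie_bracket u v * t *+ 2 =
      lie_bracket u (v * t) *+ 2 - v * lie_bracket u t *+ 2.
    by rewrite lie_bracketMr mulrnDl addrK.
  apply: (lie_ideal_sub UL); last by apply: square_closed_mul2 => //; apply: Ubr.
  by rewrite mulr2n; apply: (lie_ideal_add UL); apply: Ubr.
have -> : r * lie_bracket u v * s *+ 2 =
    lie_bracket u v * (s * r) *+ 2 - lie_bracket (lie_bracket u v * s *+ 2) r.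
  rewrite [lie_bracket (_ *+ 2) r]/lie_bracket mulrnAl mulrnAr.
  by rewrite opprB !mulrA addrC subrK.
by apply: (lie_ideal_sub UL) => //; apply: Ubr.
Qed.

Lemma semiprime_mul_sym {R : pzRingType} {a b : R} :
  semiprime_ring R -> (forall r, a * r * b = 0) -> forall r, b * r * a = 0.
Proof.
move=> Rsp ab0 r; apply: (Rsp) => s.
have -> : b * r * a * s * (b * r * a) = b * r * (a * s * b) * r * a.
  by rewrite !mulrA.
by rewrite ab0 mulr0 !mul0r.
Qed.

(** Expanding gives [a r b' = - a' r b], so [(a r b') s (a r b')] contains the factor [b s a], which
    is zero by symmetry. *)
Lemma semiprime_linearize {R : pzRingType} {a b a' b' : R} :
  semiprime_ring R ->
  (forall r, a * r * b = 0) -> (forall r, a' * r * b' = 0) ->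
  (forall r, (a + a') * r * (b + b') = 0) -> forall r, a * r * b' = 0.
Proof.
move=> Rsp ab0 ab0' abD r; apply: (Rsp) => s.
have ab'E : a * r * b' = - (a' * r * b).
  apply/eqP; rewrite -addr_eq0; apply/eqP.
  by have := abD r; rewrite mulrDl mulrDl !mulrDr ab0 ab0' add0r addr0.
rewrite {1}ab'E !mulNr.
have -> : a' * r * b * s * (a * r * b') = a' * r * (b * s * a) * r * b'.
  by rewrite !mulrA.
by rewrite (semiprime_mul_sym Rsp ab0) mulr0 !mul0r oppr0.
Qed.

Lemma lie_bracket_mul_eq0 {R : pzRingType} {U : set R} {p q : R} :
  two_torsion_free R -> lie_ideal U -> square_closed U ->
  (forall y, U y -> lie_bracket q y * p = q * lie_bracket q y) ->
  forall y z, U y -> U z -> lie_bracket q y * lie_bracket (q + p) z = 0.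
Proof.
move=> R2 UL US pqE y z Uy Uz.
have pqM : lie_bracket q (y * z) * p = q * lie_bracket q (y * z).
  apply/eqP; rewrite -subr_eq0; apply/eqP; apply: (R2).
  have := pqE _ (square_closed_mul2 UL US Uy Uz).
  by rewrite lie_bracketMnr mulrnAl mulrnAr mulrnBl => ->; rewrite subrr.
(* Expand [pqM] by Leibniz and use [pqE] at [y] and at [z]: the terms ending in [[q, z]] combine
   through [q y - y q = [q, y]]. *)
have key : lie_bracket q y * z * p =
    lie_bracket q y * p * z + lie_bracket q y * lie_bracket q z.
  apply: (addIr (y * lie_bracket q z * p)); move: pqM.
  rewrite lie_bracketMr mulrDl [q * (_ + _)]mulrDr [q * (_ * z)]mulrA -pqE // => ->.
  rewrite -addrA; congr (_ + _).
  by rewrite -mulrA pqE // !mulrA -mulrDl {2}/lie_bracket subrK.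
rewrite lie_bracketDl [_ * (lie_bracket q z + _)]mulrDr.
rewrite [lie_bracket p z]/lie_bracket [_ * (p * z - _)]mulrBr !mulrA key.
by rewrite opprD [X in _ + X]addrA subrr add0r subrr.
Qed.

Lemma lie_bracket_mulR_eq0 {R : pzRingType} {U : set R} {p q : R} :
  two_torsion_free R -> semiprime_ring R -> lie_ideal U -> square_closed U ->
  U (q + p) ->
  (forall y, U y -> lie_bracket q y * p = q * lie_bracket q y) ->
  forall y z r, U y -> U z -> lie_bracket q y * r * lie_bracket (q + p) z = 0.
Proof.
move=> R2 Rsp UL US Uc pqE y z r Uy Uz.
have prod0 := lie_bracket_mul_eq0 R2 UL US pqE.
(* Put [2 y w] for [y] in [prod0]; the summand [y [q, w] [q + p, z]] vanishes by [prod0] itself. *)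
have mid0 w : U w -> lie_bracket q y * w * lie_bracket (q + p) z = 0.
  move=> Uw; apply: (R2).
  have := prod0 _ _ (square_closed_mul2 UL US Uy Uw) Uz.
  rewrite lie_bracketMnr mulrnAl lie_bracketMr mulrDl mulrnDl.
  by rewrite -[y * _ * _]mulrA prod0 // mulr0 mul0rn addr0.
apply: (Rsp) => s; apply: (R2).
(* With [a = [q, y] r [q + p, z]], taking [w = 2 r [q + p, z] s [q, y] r] in [mid0] reads
   [2 a s a = 0]. *)
have := mid0 _ (square_closed_ideal r (s * lie_bracket q y * r) UL US Uc Uz).
by rewrite mulrnAr mulrnAl !mulrA.
Qed.

(** Kept symmetric in form to serve both implications: [q = f], [p = id] for centralizing maps, and
    the reverse for commutativity preserving ones. *)
Lemma sum_centralizes {R : pzRingType} {U : set R} {p q : R -> R} :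
  two_torsion_free R -> semiprime_ring R -> lie_ideal U -> square_closed U ->
  {morph p : x y / x + y} -> {morph q : x y / x + y} ->
  (forall x, U x -> U (p x)) -> q @` U = U ->
  (forall x y, U x -> U y ->
    lie_bracket (q x) y * p x = q x * lie_bracket (q x) y) ->
  forall x z, U x -> U z -> lie_bracket (q x + p x) z = 0.
Proof.
move=> R2 Rsp UL US pD qD pU qU pqE x z Ux Uz.
have Uc w : U w -> U (q w + p w).
  by move=> Uw; apply: (lie_ideal_add UL); [rewrite -qU; exists w | exact: pU].
have diag w y r : U w -> U y ->
    lie_bracket (q w) y * r * lie_bracket (q w + p w) z = 0.
  by move=> Uw Uy; apply: (lie_bracket_mulR_eq0 R2 Rsp UL US (Uc _ Uw)) => // *;
    apply: pqE.
(* Surjectivity of [q] on [U] gives [w] with [q w = q x + p x], so the cross term of [diag] at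
   [w + x] is exactly the product that semiprimeness needs. *)
apply: (Rsp) => r; have := Uc _ Ux; rewrite -{1}qU => -[w Uw {1}<-].
apply: (semiprime_linearize Rsp (b := lie_bracket (q w + p w) z)
          (a' := lie_bracket (q x) z)) => s; try exact: diag.
have := diag _ _ s (lie_ideal_add UL Uw Ux) Uz.
by rewrite qD pD addrACA !lie_bracketDl.
Qed.

Lemma centralizing_commuting {R : pzRingType} {U : set R} {f : R -> R} :
  two_torsion_free R -> semiprime_ring R -> lie_ideal U -> square_closed U ->
  antihomomorphism f -> centralizing_on U f ->
  forall x, U x -> lie_bracket (f x) x = 0.
Proof.
move=> R2 Rsp UL US [fD fM] fZ x Ux.
set t := lie_bracket (f x) x.
have tZ (r : R) : t * r = r * t by apply: fZ.
have tt0 : t * t = 0.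
  apply: (R2).
  (* The inner sum is the mixed part of [[f w, w]] at [w = x + x * x]. It equals [2 t (x + f x)],
     whose bracket with [x] is [2 t t]. *)
  have : lie_bracket (lie_bracket (f x) (x * x) + lie_bracket (f x * f x) x) x = 0.
    have Ux2 : U (x * x) by rewrite -expr2; exact: US.
    have fZx w : U w -> lie_bracket (lie_bracket (f w) w) x = 0.
      by move=> Uw; rewrite [LHS]/lie_bracket (fZ _ Uw x) subrr.
    have mid a b c d : lie_bracket a x = 0 -> lie_bracket d x = 0 ->
        lie_bracket (a + b + (c + d)) x = 0 -> lie_bracket (b + c) x = 0.
      by rewrite !lie_bracketDl => -> ->; rewrite add0r addr0.
    apply: (mid t _ _ (lie_bracket (f x * f x) (x * x))); first exact: fZx.
      by have := fZx _ Ux2; rewrite fM.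
    have := fZx _ (lie_ideal_add UL Ux Ux2).
    by rewrite fD fM (lie_bracketDl _ (f x)) !lie_bracketDr.
  rewrite lie_bracketMr lie_bracketMl -/t -!tZ -!mulr2n -mulrnDl -mulrDr.
  rewrite lie_bracketC lie_bracketMnr lie_bracketMr.
  rewrite [lie_bracket x t]/lie_bracket tZ subrr mul0r add0r lie_bracketDr.
  by rewrite lie_bracketxx add0r (lie_bracketC _ x) -/t mulrN mulNrn opprK.
by apply: (Rsp) => r; rewrite tZ -mulrA tt0 mulr0.
Qed.

Theorem theorem2 (R : pzRingType) (U : set R) (f : R -> R)
    (R_2tf : two_torsion_free R) (R_semiprime : semiprime_ring R)
    (U_lie : lie_ideal U) (U_sq : square_closed U)
    (f_anti : antihomomorphism f) (fU : f @` U = U) :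
  centralizing_on U f <-> strong_commutativity_preserving_on U f.
Proof.
have [fD fM] := f_anti.
have fUU x : U x -> U (f x) by move=> Ux; rewrite -fU; exists x.
have f2 x : f (x *+ 2) = f x *+ 2 by rewrite !mulr2n fD.
have cancel2 (a b : R) : a *+ 2 = b *+ 2 -> a = b.
  move=> ab; apply/eqP; rewrite -subr_eq0; apply/eqP; apply: R_2tf.
  by rewrite mulrnBl ab subrr.
split=> [fZ|fS].
  have comm := centralizing_commuting R_2tf R_semiprime U_lie U_sq f_anti fZ.
  have swap x y : U x -> U y -> lie_bracket (f x) y = lie_bracket x (f y).
    move=> Ux Uy; have := comm _ (lie_ideal_add U_lie Ux Uy).
    rewrite fD lie_bracketDl !lie_bracketDr !comm // add0r addr0.
    by move=> /eqP; rewrite addr_eq0 -lie_bracketC => /eqP.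
  have c0 : forall x z, U x -> U z -> lie_bracket (f x + x) z = 0.
    apply: (sum_centralizes (p := id)) => // x y Ux Uy; apply: cancel2.
    (* The order [y x] matters: [f] reverses it to [f x * f y], so [x] comes out on the right and
       [f x] on the left. *)
    have := swap _ _ Ux (square_closed_mul2 U_lie U_sq Uy Ux).
    rewrite f2 fM !lie_bracketMnr !lie_bracketMr comm // mulr0 addr0.
    by rewrite -(swap x x) // comm // mul0r add0r -swap.
  move=> x y Ux Uy.
  (* The chain is [[f x, f y] = - [x, f y] = [f y, x] = - [y, x]]. *)
  have /eqP := c0 _ _ Ux (fUU _ Uy); rewrite lie_bracketDl addr_eq0 => /eqP ->.
  rewrite -lie_bracketC.
  by have /eqP := c0 _ _ Uy Ux; rewrite lie_bracketDl addr_eq0 -lie_bracketC => /eqP.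
have c0 : forall x z, U x -> U z -> lie_bracket (x + f x) z = 0.
  apply: (sum_centralizes (q := id)) => //; first by rewrite image_id.
  move=> x y Ux Uy; apply: cancel2.
  (* Here the order is [x y]: [[f x, f y * f x] = [x, y] f x] is compared with [[x, x y] = x
     [x, y]]. *)
  have := fS _ _ Ux (square_closed_mul2 U_lie U_sq Ux Uy).
  rewrite f2 fM !lie_bracketMnr !lie_bracketMr !lie_bracketxx mulr0 addr0.
  by rewrite mul0r add0r fS.
move=> x Ux r.
have := c0 _ _ Ux Ux; rewrite lie_bracketDl lie_bracketxx add0r => ->.
by rewrite mul0r mulr0.
Qed.
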